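(* Let $D=\langle a,b \mid a^{9}=1=b^{2},\ bab=a^{-1}\rangle$ be the dihedral group of order $18$, and let $\mathbb{F}_q$ be a finite field with $q$ elements whose characteristic is different from $2,3,5$ and $7$. In the group algebra $\mathbb{F}_qD$ put $H_0=\langle a\rangle$, $H_1=\langle a^{3}\rangle$, $e=\widehat{H_1}-\widehat{H_0}$, $$e_{11}=\left(\frac{1+b}{2}\right)e,\qquad e_{12}=\left(\frac{1+b}{2}\right)a\left(\frac{1-b}{2}\right)e,\qquad f=e_{11}-e_{12},$$ and let $I=(\mathbb{F}_qD)f$ be the left ideal generated by $f$. Then: (1) $\dim_{\mathbb{F}_q} I=\varphi(3)=2$; (2) the weight of $I$ is $w(I)=15$; (3) if moreover the multiplicative order of $q$ modulo $9$ is $\varphi(9)=6$, then $I$ is a non-central code (that is, $I$ is not a two-sided ideal of $\mathbb{F}_qD$) which is not combinatorially equivalent to any abelian code, i.e. for every abelian group $A$ of order $18$ and every ideal $J$ of $\mathbb{F}_qA$, $I$ is not combinatorially equivalent to $J$.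
   Context: For a subgroup $H$ of a finite group $G$ with $|H|$ invertible in the field $\mathbb{F}$, $\widehat{H}=\frac{1}{|H|}\sum_{h\in H}h\in\mathbb{F}G$. $\varphi$ is Euler's totient function. The Hamming distance between $\alpha=\sum_{g\in G}\alpha_g g$ and $\beta=\sum_{g\in G}\beta_g g$ in $\mathbb{F}G$ is $d(\alpha,\beta)=|\{g\in G\mid \alpha_g\neq\beta_g\}|$. The weight of a (left) ideal $I$ is $w(I)=\min\{d(\alpha,\beta)\mid \alpha\neq\beta,\ \alpha,\beta\in I\}$. Let $G_1,G_2$ be finite groups of the same order. A combinatorial equivalence is an $\mathbb{F}$-vector space isomorphism $\phi:\mathbb{F}G_1\to\mathbb{F}G_2$ induced (by linear extension) by a bijection $G_1\to G_2$. Codes $C_1\subset\mathbb{F}G_1$ and $C_2\subset\mathbb{F}G_2$ are combinatorially equivalent if there is a combinatorial equivalence $\phi:\mathbb{F}G_1\to\mathbb{F}G_2$ with $\phi(C_1)=C_2$. *)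

(* Defs.v *)
From HB Require Import structures.
From mathcomp Require Import all_boot all_order all_algebra all_fingroup.
From mathcomp Require Import all_solvable all_field.

Set Implicit Arguments.
Unset Strict Implicit.
Unset Printing Implicit Defensive.

Import GRing.Theory.
Local Open Scope ring_scope.

(* An element of the group algebra is its coefficient function. The coefficients
   live in the regular module F^o so that {ffun _} yields an F-vector space. *)
Definition group_algebra (F : fieldType) (gT : finGroupType) : Type :=
  {ffun gT -> F^o}.

Section GroupAlgebra.

Variables (F : fieldType) (gT : finGroupType).
Local Notation A := (group_algebra F gT).

HB.instance Definition _ := Vector.copy A {ffun gT -> F^o}.

Definition ga_coef (x : A) (g : gT) : F := (x : {ffun gT -> F^o}) g.

Definition ga_of (c : gT -> F) : A := [ffun g => c g : F^o].

Definition ga_elt (g : gT) : A := ga_of (fun h => (h == g)%:R).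

Definition ga_mul (x y : A) : A :=
  ga_of (fun g => \sum_(h : gT) ga_coef x h * ga_coef y (h^-1 * g)%g).

Lemma ga_coefE c g : ga_coef (ga_of c) g = c g.
Proof. by rewrite /ga_coef /ga_of ffunE. Qed.

Lemma ga_coefP (x y : A) : ga_coef x =1 ga_coef y -> x = y.
Proof. by move=> exy; apply/ffunP=> g; apply: exy. Qed.

Lemma ga_coefD (x y : A) g : ga_coef (x + y) g = ga_coef x g + ga_coef y g.
Proof. by rewrite /ga_coef ffunE. Qed.

Lemma ga_coefZ k (x : A) g : ga_coef (k *: x) g = k * ga_coef x g.
Proof. by rewrite /ga_coef ffunE. Qed.

Fact ga_mulA : associative ga_mul.
Proof.
move=> x y z; apply: ga_coefP => g; rewrite !ga_coefE.
under eq_bigr => h _ do rewrite ga_coefE mulr_sumr.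
under [RHS]eq_bigr => h _ do rewrite ga_coefE mulr_suml.
rewrite [RHS]exchange_big /=; apply: eq_bigr => h _.
rewrite (reindex_inj (mulgI h^-1%g)) /=; apply: eq_bigr => k _.
by rewrite mulrA invMg invgK -!mulgA mulKVg.
Qed.

Fact ga_mul1l : left_id (ga_elt 1%g) ga_mul.
Proof.
move=> x; apply: ga_coefP => g; rewrite ga_coefE (bigD1 1%g) //= big1 => [|h /negPf h1].
  by rewrite ga_coefE eqxx mul1r invg1 mul1g addr0.
by rewrite ga_coefE h1 mul0r.
Qed.

Fact ga_mul1r : right_id (ga_elt 1%g) ga_mul.
Proof.
move=> x; apply: ga_coefP => g; rewrite ga_coefE (bigD1 g) //= big1 => [|h hg].
  by rewrite ga_coefE mulVg eqxx mulr1 addr0.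
by rewrite ga_coefE -eq_mulVg1 (negPf hg) mulr0.
Qed.

Fact ga_mulDl : left_distributive ga_mul +%R.
Proof.
move=> x y z; apply: ga_coefP => g; rewrite ga_coefD !ga_coefE -big_split /=.
by apply: eq_bigr => h _; rewrite ga_coefD mulrDl.
Qed.

Fact ga_mulDr : right_distributive ga_mul +%R.
Proof.
move=> x y z; apply: ga_coefP => g; rewrite ga_coefD !ga_coefE -big_split /=.
by apply: eq_bigr => h _; rewrite ga_coefD mulrDr.
Qed.

Fact ga_1neq0 : ga_elt 1%g != 0 :> A.
Proof.
apply/eqP => /(congr1 (ga_coef^~ 1%g)); rewrite ga_coefE eqxx /ga_coef ffunE.
by move/eqP; rewrite oner_eq0.
Qed.

HB.instance Definition _ := GRing.Zmodule_isNzRing.Build A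
  ga_mulA ga_mul1l ga_mul1r ga_mulDl ga_mulDr ga_1neq0.

Fact ga_scaleAl k (x y : A) : k *: (x * y) = (k *: x) * y.
Proof.
apply: ga_coefP => g; rewrite ga_coefZ !ga_coefE mulr_sumr.
by apply: eq_bigr => h _; rewrite ga_coefZ mulrA.
Qed.

HB.instance Definition _ := GRing.Lmodule_isLalgebra.Build F A ga_scaleAl.

Fact ga_scaleAr k (x y : A) : k *: (x * y) = x * (k *: y).
Proof.
apply: ga_coefP => g; rewrite ga_coefZ !ga_coefE mulr_sumr.
by apply: eq_bigr => h _; rewrite ga_coefZ mulrCA.
Qed.

HB.instance Definition _ := GRing.Lalgebra_isAlgebra.Build F A ga_scaleAr.
HB.instance Definition _ := Algebra_isFalgebra.Build F A.

Definition subgroup_avg (H : {set gT}) : A :=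
  #|H|%:R^-1 *: \sum_(h in H) ga_elt h.

Definition left_principal_ideal (f : A) : {vspace A} := limg (amulr f).

(* Ideals of a unital F-algebra are subspaces, hence the type {vspace A}. *)
Definition is_left_ideal (I : {vspace A}) : bool := ({:A} * I <= I)%VS.

Definition is_ideal (I : {vspace A}) : bool :=
  is_left_ideal I && (I * {:A} <= I)%VS.

Definition hamming (x y : A) : nat := #|[set g | ga_coef x g != ga_coef y g]|.

End GroupAlgebra.

HB.instance Definition _ (F : finFieldType) (gT : finGroupType) :=
  Finite.copy (group_algebra F gT) {ffun gT -> F}.

(* The neutral value #|gT| bounds every distance, so this is the true minimum
   as soon as I is nonzero; the weight of the zero ideal is a junk value. *)
Definition weight (F : finFieldType) (gT : finGroupType)
    (I : {vspace group_algebra F gT}) : nat :=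
  \big[minn/#|gT|]_(p : group_algebra F gT * group_algebra F gT |
      [&& p.1 != p.2, p.1 \in I & p.2 \in I]) hamming p.1 p.2.

(* A linear map sending the basis gT bijectively onto the basis hT is
   automatically an isomorphism, and forces #|gT| = #|hT|. *)
Definition combinatorial_equivalence (F : fieldType) (gT hT : finGroupType)
    (phi : 'Hom(group_algebra F gT, group_algebra F hT)) : Prop :=
  exists2 s : gT -> hT, bijective s &
    forall g, phi (ga_elt F g) = ga_elt F (s g).

Definition combinatorially_equivalent (F : fieldType) (gT hT : finGroupType)
    (C1 : {vspace group_algebra F gT}) (C2 : {vspace group_algebra F hT}) :=
  exists2 phi : 'Hom(group_algebra F gT, group_algebra F hT),
    combinatorial_equivalence phi & (phi @: C1)%VS = C2.

(* Main.v *)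
Require Import Defs.
From HB Require Import structures.
From mathcomp Require Import all_boot all_order all_algebra all_fingroup.
From mathcomp Require Import all_solvable all_field.
From mathcomp Require Import ring zify.

(** The code I is spanned by f and A f, whose coefficients are constant on the six cosets of
    <a^3>. On these cosets a codeword k f + l A f takes values given by six linear forms in
    (k, l), whose 2 x 2 minors only involve the primes 2, 3, 5, 7. So a nonzero codeword
    vanishes on at most one coset, which gives dimension 2 and weight 18 - 3 = 15.
    An equivalent abelian code would be 2-dimensional with a word vanishing at exactly
    three points. When q has order 6 modulo 9, F has no primitive cube root of unity, and
    then the zero set of a word of a 2-dimensional abelian code of length 18 has even size,
    or is a union of cosets of the subgroup of order 9. *)

Set Implicit Arguments.
Unset Strict Implicit.
Unset Printing Implicit Defensive.

Import GRing.Theory.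
Local Open Scope ring_scope.

(** * Coefficients in a group algebra *)

Section GroupAlgebraTheory.
Variables (F : fieldType) (gT : finGroupType).
Implicit Types (x y z : group_algebra F gT) (g h : gT).

Lemma ga_coefB x y g : ga_coef (x - y) g = ga_coef x g - ga_coef y g.
Proof. by rewrite /ga_coef !ffunE. Qed.

Lemma ga_coef0 g : ga_coef (0 : group_algebra F gT) g = 0.
Proof. by rewrite /ga_coef ffunE. Qed.

Lemma ga_coef_sum (I : finType) (P : pred I) (G : I -> group_algebra F gT) g :
  ga_coef (\sum_(i | P i) G i) g = \sum_(i | P i) ga_coef (G i) g.
Proof.
apply: (big_morph (fun x => ga_coef x g)) => [x y|].
  exact: ga_coefD.
exact: ga_coef0.
Qed.

Lemma ga_coef_eltM g y h : ga_coef (ga_elt F g * y) h = ga_coef y (g^-1 * h)%g.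
Proof.
rewrite ga_coefE (bigD1 g) //= big1 => [|k /negPf kg].
  by rewrite ga_coefE eqxx mul1r addr0.
by rewrite ga_coefE kg mul0r.
Qed.

Lemma ga_coef_Melt x g h : ga_coef (x * ga_elt F g) h = ga_coef x (h * g^-1)%g.
Proof.
rewrite ga_coefE (bigD1 (h * g^-1)%g) //= big1 => [|k kg].
  by rewrite ga_coefE invMg invgK mulgKV eqxx mulr1 addr0.
rewrite ga_coefE; case: eqP => [e|]; last by rewrite mulr0.
by case/eqP: kg; rewrite -e invMg invgK mulKVg.
Qed.

Lemma ga_eltM g h : ga_elt F (g * h)%g = ga_elt F g * ga_elt F h.
Proof.
apply: ga_coefP => k; rewrite ga_coef_eltM !ga_coefE.
by rewrite -(inj_eq (mulgI g^-1%g)) mulKg.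
Qed.

Lemma ga_elt1 : ga_elt F (1%g : gT) = 1. Proof. by []. Qed.

Lemma ga_eltX g n : ga_elt F (g ^+ n)%g = ga_elt F g ^+ n.
Proof. by elim: n => [|n IHn] //; rewrite expgS exprS ga_eltM IHn. Qed.

Lemma ga_expand x : x = \sum_g ga_coef x g *: ga_elt F g.
Proof.
apply: ga_coefP => h; rewrite ga_coef_sum (bigD1 h) //= big1 => [|k kh].
  by rewrite ga_coefZ ga_coefE eqxx mulr1 addr0.
by rewrite ga_coefZ ga_coefE eq_sym (negPf kh) mulr0.
Qed.

Lemma ga_coef_avg (H : {group gT}) g :
  ga_coef (subgroup_avg F H) g = (g \in H)%:R / #|H|%:R.
Proof.
rewrite /subgroup_avg ga_coefZ ga_coef_sum mulrC; congr (_ * _).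
have [Hg|Hg] := boolP (g \in H).
  rewrite (bigD1 g) //= big1 => [|h /andP[_ hg]]; rewrite ga_coefE.
    by rewrite eqxx addr0.
  by rewrite eq_sym (negPf hg).
rewrite big1 // => h Hh; rewrite ga_coefE; case: eqP => // e.
by rewrite e Hh in Hg.
Qed.

Lemma left_principal_ideal_min (W : {vspace group_algebra F gT}) f :
    f \in W -> (forall g x, x \in W -> ga_elt F g * x \in W) ->
  (left_principal_ideal f <= W)%VS.
Proof.
move=> Wf Wstab; apply/subvP => _ /memv_imgP[x _ ->]; rewrite lfunE /=.
rewrite [x]ga_expand mulr_suml memv_suml // => g _.
by rewrite -scalerAl memvZ // Wstab.
Qed.

Lemma mem_left_principal_ideal x f : x * f \in left_principal_ideal f.
Proof. by apply/memv_imgP; exists x; rewrite ?memvf ?lfunE. Qed.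

Lemma hamming_subr x y : hamming x y = #|[set g | ga_coef (x - y) g != 0]|.
Proof. by apply: eq_card => g; rewrite !inE ga_coefB subr_eq0. Qed.

End GroupAlgebraTheory.

Lemma bigminn_le (T : eqType) (r : seq T) (P : pred T) (G : T -> nat) d i :
  i \in r -> P i -> (\big[minn/d]_(j <- r | P j) G j <= G i)%N.
Proof.
elim: r => //= j r IHr; rewrite inE big_cons => /orP[/eqP<- ->|ri Pi].
  exact: geq_minl.
by case: ifP => _; [apply: leq_trans (geq_minr _ _) _|]; apply: IHr.
Qed.

(** * The dihedral group of order 18 and the coefficients of [f] *)

(** The known group ['D_18] satisfies the same relations, so it is a homomorphic image of [gT]. *)
Lemma dihedral18_card (gT : finGroupType) :
  ([set: gT] \isog Grp (x : y : x ^+ 9, y ^+ 2, y * x * y = x^-1))%g ->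
  (18 <= #|[set: gT]|)%N.
Proof.
move=> hD; have card18 := @card_dihedral 9 isT.
have := homg_refl [set: 'D_(9.*2)].
rewrite (Grp_dihedral (isT : 1 < 9)%N) => /existsP[[x y]] /=.
rewrite !xpair_eqE => /and4P[/eqP defG /eqP x9 /eqP y2 /eqP xy].
rewrite -[18%N]card18; apply: leq_homg.
rewrite hD; apply/existsP; exists (x, y); rewrite /= !xpair_eqE defG x9 y2 !eqxx /=.
have yV : (y^-1 = y)%g by apply/eqP; rewrite eq_invg_mul -expg2 y2.
by rewrite -xy conjgE yV mulgA.
Qed.

(** With [k] equal to 1/2, this turns [f] into a combination of left translates of [e], whose
    coefficients can be read off directly. *)
Lemma e11_sub_e12E (R : fieldType) (L : algType R) (k : R) (x y z : L) :
  (k *: (1 + y)) * z - (k *: (1 + y)) * x * (k *: (1 - y)) * z =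
  k *: (z + y * z)
  - (k * k) *: (x * z - x * (y * z) + y * (x * z) - y * (x * (y * z))).
Proof.
rewrite -!scalerAl -!scalerAr -!scalerAl scalerA mulrDl mul1r.
congr (_ - _ *: _).
by rewrite mulrDl mul1r mulrBr mulr1 !(mulrDl, mulNr) !mulrA opprD addrA;
  congr (_ - _); rewrite addrAC.
Qed.

Section Dihedral.
Variables (F : fieldType) (gT : finGroupType) (a b : gT).
Hypothesis card18 : (18 <= #|[set: gT]|)%N.
Hypothesis hgen : (<<[set a; b]>> = [set: gT])%g.
Hypothesis ha : (a ^+ 9 = 1)%g.
Hypothesis hb : (b ^+ 2 = 1)%g.
Hypothesis hab : (b * a * b = a^-1)%g.

Definition dihedral_word (p : bool * 'I_9) : gT := (a ^+ p.2 * b ^+ p.1)%g.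

Let bV : (b^-1 = b)%g.
Proof. by apply/eqP; rewrite eq_invg_mul -expg2 hb. Qed.

Let aV : (a^-1 = a ^+ 8)%g.
Proof. by apply/eqP; rewrite eq_invg_mul -expgS ha. Qed.

Let aJb : (a ^ b = a^-1)%g.
Proof. by rewrite conjgE bV mulgA. Qed.

(** Since [b] normalizes [<[a]>], every element is a word a^i b^j. There are 18 such words for at
    least 18 elements, so none coincide. *)
Lemma dihedral_word_bij : bijective dihedral_word.
Proof.
have surj g : exists p, g = dihedral_word p.
  have nab : <[b]>%g \subset 'N(<[a]>)%g.
    by rewrite cycle_subG inE -cycleJ aJb cycleV.
  have: g \in (<[a]> <*> <[b]>)%g.
    have -> : (<[a]> <*> <[b]> = [set: gT])%g by rewrite joing_idl joing_idr.
    by rewrite inE.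
  rewrite norm_joinEr // => /mulsgP[_ _ /cycleP[i ->] /cycleP[j ->] ->].
  exists (odd j, inord (i %% 9)); rewrite /dihedral_word /= inordK ?ltn_mod //.
  by rewrite expg_mod // -modn2 expg_mod.
have imT : [set: gT] \subset dihedral_word @: setT.
  by apply/subsetP => g _; have [p ->] := surj g; apply: imset_f.
apply: inj_card_bij; last first.
  by rewrite -!cardsT (leq_trans (subset_leq_card imT)) ?leq_imset_card.
have inj : {in setT &, injective dihedral_word}.
  apply/imset_injP; rewrite eqn_leq leq_imset_card /=.
  rewrite cardsT card_prod card_bool card_ord.
  exact: leq_trans card18 (subset_leq_card imT).
by move=> p q; apply: inj; rewrite inE.
Qed.

Lemma dihedral_pow_inj i j k l : (i < 9)%N -> (j < 9)%N ->
  (a ^+ i * b ^+ (k : bool) = a ^+ j * b ^+ (l : bool))%g -> i = j /\ k = l.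
Proof.
move=> i9 j9 e; have /bij_inj inj := dihedral_word_bij.
by have [-> ->] := inj (k, Ordinal i9) (l, Ordinal j9) e.
Qed.

Lemma dihedral_order_a : #[a]%g = 9.
Proof.
have n9 : (#[a]%g %| 9)%N by rewrite order_dvdn ha.
apply/eqP; rewrite eqn_leq dvdn_leq //= leqNgt; apply/negP => lt9.
have [] := @dihedral_pow_inj #[a]%g 0 false false lt9 isT.
  by rewrite expg_order.
by move=> a0; have := order_gt0 a; rewrite a0.
Qed.

Lemma dihedral_mem_powers d i (j : bool) : (d %| 9)%N ->
  (a ^+ i * b ^+ j \in <[a ^+ d]>)%g = ~~ j && (d %| i)%N.
Proof.
move=> d9; apply/cycleP/andP => [[k]|[/negPf-> /dvdnP[k ->]]]; last first.
  by exists k; rewrite mulg1 mulnC expgM.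
rewrite -expgM -(expg_mod i ha) -(expg_mod (d * k) ha) => e.
have [|||ik ->] := @dihedral_pow_inj (i %% 9) ((d * k) %% 9) j false.
- by rewrite ltn_mod.
- by rewrite ltn_mod.
- by rewrite e mulg1.
split=> //; rewrite (divn_eq i 9) dvdn_addr ?dvdn_mull // ik.
by rewrite -(dvdn_addr _ (dvdn_mull (d * k %/ 9) d9)) -divn_eq dvdn_mulr.
Qed.

(** As 8 is -1 modulo 9, exponents remain natural numbers; the boolean exponent of [b] is flipped by
    a factor [b]. *)
Lemma dihedral_mulVa i j : (a^-1 * (a ^+ i * b ^+ j) = a ^+ (i + 8) * b ^+ j)%g.
Proof. by rewrite mulgA aV -expgD addnC. Qed.

Lemma dihedral_mulVb i (j : bool) :
  (b^-1 * (a ^+ i * b ^+ j) = a ^+ (8 * i) * b ^+ (~~ j))%g.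
Proof.
rewrite bV expgM -aV -aJb -conjXg conjgE bV -!mulgA; congr (_ * (_ * _))%g.
by case: j; rewrite ?expg1 ?mulg1 ?expg0 ?mulg1 // -expg2 hb.
Qed.

Lemma dihedral_mulbV i (j : bool) :
  (a ^+ i * b ^+ j * b^-1 = a ^+ i * b ^+ (~~ j))%g.
Proof.
rewrite -mulgA bV; congr (_ * _)%g.
by case: j; rewrite ?expg1 ?expg0 ?mul1g // -expg2 hb.
Qed.

Local Notation e :=
  (subgroup_avg F <[(a ^+ 3)%g]>%g - subgroup_avg F <[a]>%g).
Local Notation A := (ga_elt F a).
Local Notation B := (ga_elt F b).

Hypothesis F2 : 2%:R != 0 :> F.
Hypothesis F3 : 3%:R != 0 :> F.

(** On [<[a ^+ 3]>] the value is 1/3 - 1/9, on the rest of [<[a]>] it is 0 - 1/9. *)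
Lemma dihedral_coef_e i (j : bool) : ga_coef e (a ^+ i * b ^+ j)%g =
  if j then 0 else if (3 %| i)%N then 2%:R / 9%:R else - 9%:R^-1.
Proof.
have n9 : 9%:R != 0 :> F by rewrite (natrM _ 3 3) mulf_neq0.
rewrite ga_coefB !ga_coef_avg -!orderE orderXdiv dihedral_order_a // (_ : 9 %/ 3 = 3)%N //.
rewrite (dihedral_mem_powers i j (isT : 3 %| 9)%N).
have := dihedral_mem_powers i j (isT : 1 %| 9)%N; rewrite expg1 dvd1n => ->.
by case: j; case: (3 %| i)%N; rewrite ?mul0r ?subr0 ?sub0r ?mul1r //=; field; rewrite ?n9 ?F3.
Qed.

Definition dihedral_f : group_algebra F gT :=
  ((2%:R : F)^-1 *: (1 + B)) * e
  - ((2%:R : F)^-1 *: (1 + B)) * A * ((2%:R : F)^-1 *: (1 - B)) * e.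

(* 36 times the coefficient of f at a^i b^j. *)
Definition coset_coef (j : bool) (i : nat) : F :=
  if (i %% 3 == 0)%N then 4%:R
  else if (i %% 3 == 1)%N (+) j then - 5%:R else 1.

Lemma dihedral_coef_f i (j : bool) :
  ga_coef dihedral_f (a ^+ i * b ^+ j)%g = coset_coef j i / 36%:R.
Proof.
have n9 : 9%:R != 0 :> F by rewrite (natrM _ 3 3) mulf_neq0.
have n36 : 36%:R != 0 :> F by rewrite (natrM _ 4 9) (natrM _ 2 2) !mulf_neq0.
have -> : dihedral_f = 2%:R^-1 *: (e + B * e)
   - (2%:R^-1 * 2%:R^-1) *: (A * e - A * (B * e) + B * (A * e) - B * (A * (B * e))).
  rewrite /dihedral_f; exact: e11_sub_e12E.
have := dihedral_coef_e; move: (e) => E coefE.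
rewrite !(ga_coefB, ga_coefZ, ga_coefD) !ga_coef_eltM.
rewrite !(dihedral_mulVa, dihedral_mulVb) !coefE /coset_coef.
(* The coefficients of [e] depend on the exponent of [a] modulo 3 only. Reducing each translated
   exponent leaves six cases. *)
have -> : (3 %| i)%N = (i %% 3 == 0)%N by [].
have -> : (3 %| i + 8)%N = (i %% 3 == 1)%N by lia.
have -> : (3 %| 8 * i)%N = (i %% 3 == 0)%N by lia.
have -> : (3 %| 8 * (i + 8))%N = (i %% 3 == 1)%N by lia.
have -> : (3 %| 8 * i + 8)%N = (i %% 3 == 2)%N by lia.
have -> : (3 %| 8 * (8 * i + 8))%N = (i %% 3 == 2)%N by lia.
have := ltn_pmod i (isT : 0 < 3)%N.
by case: (i %% 3)%N => [|[|[|]]] // _; case: j => /=; field; rewrite ?F2 ?n36 ?n9.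
Qed.

End Dihedral.

(** * The code [I]: basis, weights and failure of right stability *)

Section DihedralCode.
Variables (F : fieldType) (gT : finGroupType) (a b : gT).
Hypothesis card18 : (18 <= #|[set: gT]|)%N.
Hypothesis hgen : (<<[set a; b]>> = [set: gT])%g.
Hypothesis ha : (a ^+ 9 = 1)%g.
Hypothesis hb : (b ^+ 2 = 1)%g.
Hypothesis hab : (b * a * b = a^-1)%g.
Hypothesis F2 : 2%:R != 0 :> F.
Hypothesis F3 : 3%:R != 0 :> F.
Hypothesis F5 : 5%:R != 0 :> F.
Hypothesis F7 : 7%:R != 0 :> F.

Local Notation A := (ga_elt F a).
Local Notation B := (ga_elt F b).
Local Notation f := (dihedral_f F a b).
Local Notation I := (left_principal_ideal f).
Local Notation coef_f := (dihedral_coef_f card18 hgen ha hb hab F2 F3).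

Let F36 : 36%:R != 0 :> F.
Proof. by rewrite (natrM _ 4 9) (natrM _ 2 2) (natrM _ 3 3) !mulf_neq0. Qed.

Let F2520 : 2520%:R != 0 :> F.
Proof.
by rewrite (natrM _ 36 70) (natrM _ 2 35) (natrM _ 5 7) !mulf_neq0.
Qed.

Lemma dihedral_coefP (x y : group_algebra F gT) :
  (forall i (j : bool), ga_coef x (a ^+ i * b ^+ j)%g = ga_coef y (a ^+ i * b ^+ j)%g) ->
  x = y.
Proof.
move=> exy; apply: ga_coefP => g.
have [h _ hK] := dihedral_word_bij card18 hgen ha hb hab.
by rewrite -[g]hK exy.
Qed.

Definition codeword (k l : F) : group_algebra F gT := k *: f + l *: (A * f).

Lemma coef_codeword k l i (j : bool) :
  ga_coef (codeword k l) (a ^+ i * b ^+ j)%g =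
  (k * coset_coef F j i + l * coset_coef F j (i + 8)) / 36%:R.
Proof.
rewrite ga_coefD !ga_coefZ ga_coef_eltM (dihedral_mulVa b ha) !coef_f.
by rewrite mulrDl !mulrA.
Qed.

(** Both terms of [f] start with the factor 1 + b, which absorbs [b]. *)
Lemma mulB_f : B * f = f.
Proof.
apply: dihedral_coefP => i j; rewrite ga_coef_eltM (dihedral_mulVb ha hb hab).
rewrite !coef_f; congr (_ / _); rewrite /coset_coef.
have -> : (8 * i %% 3 == 0)%N = (i %% 3 == 0)%N by clear; lia.
have -> : (8 * i %% 3 == 1)%N = (i %% 3 == 2)%N by clear; lia.
have := ltn_pmod i (isT : 0 < 3)%N.
by case: (i %% 3)%N => [|[|[|]]] // _; case: j.
Qed.

(** Behind this is (1 + a + a^2) e = 0 with [e] central; the check itself is coefficientwise. *)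
Lemma mulAA_f : A * (A * f) = codeword (-1) (-1).
Proof.
apply: dihedral_coefP => i j; rewrite !ga_coef_eltM !(dihedral_mulVa b ha).
rewrite coef_f coef_codeword; congr (_ / _); rewrite /coset_coef.
have -> : ((i + 8 + 8) %% 3 == 0)%N = (i %% 3 == 2)%N by clear; lia.
have -> : ((i + 8 + 8) %% 3 == 1)%N = (i %% 3 == 0)%N by clear; lia.
have -> : ((i + 8) %% 3 == 0)%N = (i %% 3 == 1)%N by clear; lia.
have -> : ((i + 8) %% 3 == 1)%N = (i %% 3 == 2)%N by clear; lia.
have := ltn_pmod i (isT : 0 < 3)%N.
by case: (i %% 3)%N => [|[|[|]]] // _; case: j => /=; ring.
Qed.

(** Conceptually, b a f = a^-1 b f = a^-1 f = a^2 f, because a^3 fixes [f]. *)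
Lemma mulBA_f : B * (A * f) = codeword (-1) (-1).
Proof.
apply: dihedral_coefP => i j.
rewrite !ga_coef_eltM (dihedral_mulVb ha hb hab) (dihedral_mulVa b ha).
rewrite coef_f coef_codeword; congr (_ / _); rewrite /coset_coef.
have -> : ((8 * i + 8) %% 3 == 0)%N = (i %% 3 == 2)%N by clear; lia.
have -> : ((8 * i + 8) %% 3 == 1)%N = (i %% 3 == 1)%N by clear; lia.
have -> : ((i + 8) %% 3 == 0)%N = (i %% 3 == 1)%N by clear; lia.
have -> : ((i + 8) %% 3 == 1)%N = (i %% 3 == 2)%N by clear; lia.
have := ltn_pmod i (isT : 0 < 3)%N.
by case: (i %% 3)%N => [|[|[|]]] // _; case: j => /=; ring.
Qed.

Lemma codeword_mulA k l : A * codeword k l = codeword (- l) (k - l).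
Proof.
rewrite mulrDr -!scalerAr mulAA_f /codeword !scaleN1r scalerDr !scalerN.
by rewrite scalerBl scaleNr addrCA.
Qed.

Lemma codeword_mulB k l : B * codeword k l = codeword (k - l) (- l).
Proof.
rewrite mulrDr -!scalerAr mulB_f mulBA_f /codeword.
move: (A * f) f => y x.
by rewrite !scaleN1r scalerDr !scalerN scalerBl scaleNr addrA.
Qed.

Lemma codeword_span k l : codeword k l \in <<[:: f; (A * f)%R]>>%VS.
Proof. by rewrite memvD // memvZ // memv_span // !inE eqxx ?orbT. Qed.

Lemma mem_span_codeword z :
  z \in <<[:: f; (A * f)%R]>>%VS -> exists k l, z = codeword k l.
Proof.
rewrite span_cons span_seq1 => /memv_addP[_ /vlineP[k ->] [_ /vlineP[l ->] ->]].
by exists k, l.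
Qed.

(** The span is stable under [a] and [b] by the coordinate formulas above, hence under every word in
    them. *)
Lemma dihedral_ideal_span : I = <<[:: f; (A * f)%R]>>%VS.
Proof.
apply/eqP; rewrite eqEsubv; apply/andP; split; last first.
  apply/span_subvP => z; rewrite !inE => /orP[]/eqP->.
    by rewrite -[X in X \in _]mul1r mem_left_principal_ideal.
  exact: mem_left_principal_ideal.
apply: left_principal_ideal_min => [|g z]; first by rewrite memv_span ?mem_head.
have [h _ hK] := dihedral_word_bij card18 hgen ha hb hab.
rewrite -[g]hK /dihedral_word; case: (h g) => j i /=.
rewrite ga_eltM !ga_eltX -mulrA => Wz.
suff : B ^+ j * z \in <<[:: f; (A * f)%R]>>%VS.
  elim: (nat_of_ord i) (B ^+ j * z) => [|n IHn] x Wx; first by rewrite mul1r.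
  rewrite exprSr -mulrA; apply: IHn.
  by have [k [l ->]] := mem_span_codeword Wx; rewrite codeword_mulA codeword_span.
case: j => /=; rewrite ?mul1r // expr1.
have [k [l ->]] := mem_span_codeword Wz.
by rewrite codeword_mulB codeword_span.
Qed.

Lemma card_dihedral_pred (P : pred gT) :
  #|[set g | P g]| = (\sum_(j : bool) \sum_(i < 9) P (a ^+ i * b ^+ j)%g)%N.
Proof.
have bij := dihedral_word_bij card18 hgen ha hb hab.
rewrite cardsE -sum1_card big_mkcond /= (reindex _ (onW_bij _ bij)) /=.
rewrite pair_bigA /=; apply: eq_bigr => -[j i] _ /=.
by rewrite -[_ \in _]/(P (a ^+ i * b ^+ j)%g); case: (P _).
Qed.

(* 36 times the coefficients of codeword k l on the six cosets of <a^3>, as linear forms in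
   (k, l). *)
Definition codeword_forms : seq (F * F) :=
  [:: (4%:R, 1); (- 5%:R, 4%:R); (1, - 5%:R);
      (4%:R, - 5%:R); (1, 4%:R); (- 5%:R, 1)].

Lemma codeword_weight k l :
  #|[set g | ga_coef (codeword k l) g != 0]| =
  (3 * count (fun p : F * F => k * p.1 + l * p.2 != 0)%R codeword_forms)%N.
Proof.
rewrite (card_dihedral_pred (fun g => ga_coef (codeword k l) g != 0)).
have E (j : bool) i : (ga_coef (codeword k l) (a ^+ i * b ^+ j)%g != 0) =
    (k * coset_coef F j i + l * coset_coef F j (i + 8) != 0).
  by rewrite coef_codeword mulf_eq0 invr_eq0 (negPf F36) orbF.
under eq_bigr => j _ do under eq_bigr => i _ do rewrite E.
rewrite big_bool !big_ord_recl !big_ord0 /coset_coef /=.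
(* The 18 summands show only six distinct conditions, each occurring three times. *)
by do 6!case: (_ != 0)%R.
Qed.

(* Every 2 x 2 minor of the six forms divides 2520 = 2^3 * 3^2 * 5 * 7. *)
Lemma codeword_forms_indep (k l : F) :
    (k, l) != (0, 0) ->
  (5 <= count (fun p : F * F => k * p.1 + l * p.2 != 0)%R codeword_forms)%N.
Proof.
move=> kl0.
(* Cramer's rule, with every determinant scaled to 2520 so that one nonvanishing constant serves all
   pairs of forms. *)
have minor (c p q r s : F) : c * (p * s - q * r) = 2520%:R ->
    k * p + l * q = 0 -> k * r + l * s = 0 -> False.
  move=> cE e1 e2; case/negP: kl0; rewrite xpair_eqE.
  apply/andP; split; apply/eqP; apply: (mulfI F2520); rewrite mulr0 -cE.
    have -> : c * (p * s - q * r) * k =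
      c * (s * (k * p + l * q) - q * (k * r + l * s)) by ring.
    by rewrite e1 e2 !mulr0 subr0 mulr0.
  have -> : c * (p * s - q * r) * l =
    c * (p * (k * r + l * s) - r * (k * p + l * q)) by ring.
  by rewrite e1 e2 !mulr0 subr0 mulr0.
(* Up to sign the minors are 21, 24, 15 and 9, with cofactors 120, 105, 168 and 280 in 2520. The
   sign is settled by the order in which the two equations are matched. *)
rewrite /=; do 6!case: (eqVneq (k * _ + _) 0) => ? //=; exfalso;
match goal with
| e1 : k * _ + _ = 0, e2 : k * _ + _ = 0 |- _ =>
  first [ by apply: (minor 120%:R _ _ _ _ _ e1 e2); ring
        | by apply: (minor 105%:R _ _ _ _ _ e1 e2); ring
        | by apply: (minor 168%:R _ _ _ _ _ e1 e2); ring
        | by apply: (minor 280%:R _ _ _ _ _ e1 e2); ring ]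
end.
Qed.


Lemma codeword_weight_ge k l : (k, l) != (0, 0) ->
  (15 <= #|[set g | ga_coef (codeword k l) g != 0%R]|)%N.
Proof.
by move=> kl0; rewrite codeword_weight (leq_mul2l 3 5) codeword_forms_indep.
Qed.

Lemma codeword_eq0 k l : codeword k l = 0 -> (k, l) = (0, 0).
Proof.
move=> w0; apply/eqP/negPn/negP => /codeword_weight_ge; rewrite w0.
by under eq_finset do rewrite ga_coef0 eqxx; rewrite cards0.
Qed.

Lemma dihedral_ideal_dim : \dim I = 2.
Proof.
rewrite dihedral_ideal_span; apply/eqP.
rewrite -[_ == _]/(free [:: f; (A * f)%R]) free_cons span_seq1 seq1_free.
apply/andP; split.
  apply/negP => /vlineP[l e].
  have : codeword 1 (- l) = 0 by rewrite /codeword scale1r {1}e scaleNr subrr.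
  by move/codeword_eq0 => [] /eqP; rewrite oner_eq0.
apply/eqP => e; have : codeword 0 1 = 0 by rewrite /codeword scale0r e scaler0 addr0.
by move/codeword_eq0 => [] /eqP; rewrite oner_eq0.
Qed.

(** The pair (1, -4) is chosen to kill the form (4, 1). The other five forms take the values -21,
    21, 24, -15, -9, whose prime factors are invertible in [F]. *)
Lemma codeword_weight15 :
  #|[set g | ga_coef (codeword 1 (- 4%:R)) g != 0]| = 15%N.
Proof.
rewrite codeword_weight /=.
have -> : 1 * 4%:R + - 4%:R * 1 = 0 :> F by ring.
have -> : 1 * - 5%:R + - 4%:R * 4%:R = - (3%:R * 7%:R) :> F by ring.
have -> : 1 * 1 + - 4%:R * - 5%:R = 3%:R * 7%:R :> F by ring.
have -> : 1 * 4%:R + - 4%:R * - 5%:R = 2%:R * 2%:R * 2%:R * 3%:R :> F by ring.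
have -> : 1 * 1 + - 4%:R * 4%:R = - (3%:R * 5%:R) :> F by ring.
have -> : 1 * - 5%:R + - 4%:R * 1 = - (3%:R * 3%:R) :> F by ring.
by rewrite eqxx !oppr_eq0 !mulf_neq0.
Qed.

Lemma dihedral_ideal_not_ideal : ~~ is_ideal I.
Proof.
apply/negP => /andP[_ /subvP Iid].
have fI : f \in I by rewrite -[X in X \in _]mul1r mem_left_principal_ideal.
have := Iid _ (memv_mul fI (memvf B)).
rewrite dihedral_ideal_span => /mem_span_codeword[k [l e]].
have coefE i (j : bool) :
    coset_coef F (~~ j) i = k * coset_coef F j i + l * coset_coef F j (i + 8).
  apply: (mulIf (invr_neq0 F36)).
  by rewrite -coef_codeword -e ga_coef_Melt (dihedral_mulbV _ hb) coef_f.
(* If f b = k f + l a f, these points give 4k - 5l = 4, 4k + l = 4 and k + 4l = -5. The first two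
   force l = 0, and then 24 = 0. *)
have := coefE 0%N true; have := coefE 0%N false; have := coefE 1%N true.
rewrite /coset_coef /= => e1 e2 e3.
have : 6%:R * l = 0.
  have -> : 6%:R * l = (k * 4%:R + l * 1) - (k * 4%:R + l * - 5%:R) by ring.
  by rewrite -e2 -e3 subrr.
move/eqP; rewrite mulf_eq0 (natrM _ 2 3) !mulf_eq0 (negPf F2) (negPf F3) /=.
move=> /eqP l0; rewrite l0 !mul0r !addr0 mulr1 in e1 e3.
have : 24%:R = 0 :> F.
  have -> : 24%:R = 4%:R - (- 5%:R) * 4%:R :> F by ring.
  by rewrite {1}e3 e1 subrr.
move/eqP; rewrite (natrM _ 4 6) (natrM _ 2 2) (natrM _ 2 3).
by rewrite !mulf_eq0 (negPf F2) (negPf F3).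
Qed.

End DihedralCode.

Lemma dihedral_ideal_weight (F : finFieldType) (gT : finGroupType) (a b : gT) :
  (18 <= #|[set: gT]|)%N -> (<<[set a; b]>> = [set: gT])%g ->
  (a ^+ 9 = 1)%g -> (b ^+ 2 = 1)%g -> (b * a * b = a^-1)%g ->
  2%:R != 0 :> F -> 3%:R != 0 :> F -> 5%:R != 0 :> F -> 7%:R != 0 :> F ->
  weight (left_principal_ideal (dihedral_f F a b)) = 15.
Proof.
move=> card18 hgen ha hb hab F2 F3 F5 F7.
have spanI := dihedral_ideal_span card18 hgen ha hb hab F2 F3.
apply/eqP; rewrite eqn_leq /weight; apply/andP; split.
  pose c := codeword a b (1 : F) (- 4%:R).
  have c15 : #|[set g | ga_coef c g != 0]| = 15%N.
    exact: (codeword_weight15 card18 hgen ha hb hab F2 F3 F5 F7).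
  rewrite -[X in (_ <= X)%N]c15 -[X in ga_coef X]subr0 -hamming_subr.
  apply: (@bigminn_le _ _ _ _ _ (c, 0)); first exact: mem_index_enum.
  rewrite /= mem0v spanI codeword_span !andbT.
  by apply/eqP => c0; rewrite c0 in c15; move: c15;
    under eq_finset do rewrite ga_coef0 eqxx; rewrite cards0.
(* The default value [#|gT|] of the minimum is at least 18, so it respects the bound too. *)
apply: (big_ind (fun n => 15 <= n)%N) => [|m n m15 n15|[x y] /and3P[/= xy Ix Iy]].
- by rewrite -cardsT (leq_trans _ card18).
- by rewrite leq_min m15.
have [k [l e]] : exists k l, x - y = codeword a b k l.
  by apply: mem_span_codeword; rewrite -spanI memvB.
rewrite hamming_subr e codeword_weight_ge //.
apply: contraNneq xy => -[k0 l0]; rewrite -subr_eq0 e k0 l0.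
by rewrite /codeword !scale0r addr0.
Qed.

(** * Transfer to abelian codes and their zero sets *)

Lemma combinatorial_equivalence_coef (F : fieldType) (gT hT : finGroupType)
    (phi : 'Hom(group_algebra F gT, group_algebra F hT)) (s : gT -> hT) x g :
    injective s -> (forall g, phi (ga_elt F g) = ga_elt F (s g)) ->
  ga_coef (phi x) (s g) = ga_coef x g.
Proof.
move=> s_inj phiE; rewrite [x in phi x]ga_expand linear_sum ga_coef_sum.
rewrite (bigD1 g) //= linearZ ga_coefZ /= phiE ga_coefE eqxx mulr1 big1 ?addr0 //.
move=> h hg; rewrite linearZ ga_coefZ /= phiE ga_coefE (inj_eq s_inj) eq_sym.
by rewrite (negPf hg) mulr0.
Qed.

(** The order of [x] divides both [n] and the order of the multiplicative group; Bezout makes it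
    1. *)
Lemma finField_coprime_root1 (F : finFieldType) (x : F) n :
  (0 < n)%N -> coprime n #|F|.-1 -> x ^+ n = 1 -> x = 1.
Proof.
move=> n0 /eqP co xn.
have x0 : x != 0.
  by apply: contra_eq_neq xn => ->; rewrite expr0n eqn0Ngt n0 eq_sym oner_eq0.
have xq : x ^+ #|F|.-1 = 1.
  apply: (mulfI x0); rewrite -exprS mulr1 prednK ?expf_card //.
  exact: ltnW (finNzRing_gt1 _).
have [km kn e _] := egcdnP #|F|.-1 n0.
have : x ^+ (km * n) = 1 by rewrite mulnC exprM xn expr1n.
by rewrite e co addn1 exprS mulnC exprM xq expr1n mulr1.
Qed.

(** Right translation by [t] has no fixed point, and a 2-group action preserves cardinality modulo 2
    on passing to fixed points. *)
Lemma even_card_involution (gT : finGroupType) (t : gT) (Z : {set gT}) :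
  #[t]%g = 2 -> (forall g, (g * t \in Z)%g = (g \in Z)) -> ~~ odd #|Z|.
Proof.
move=> ot Zt.
have t2 : (2.-group <[t]>)%g by rewrite /pgroup -orderE ot.
have actsZ : [acts <[t]>, on Z | 'R]%g by rewrite cycle_subG; apply/astabsP => g; apply: Zt.
have := pgroup_fix_mod t2 actsZ; rewrite (_ : 'Fix_(_ | _)(_)%g = set0) ?cards0.
  by rewrite !modn2; case: odd.
apply/setP => g; rewrite in_setI in_set0; apply/negP => /andP[_ /afixP fix_g].
have /eqP := fix_g t (cycle_id t).
by rewrite -[X in _ == X]mulg1 /= (inj_eq (mulgI g)) -order_eq1 ot.
Qed.

Section AbelianCode.
Variables (F : finFieldType) (aT : finGroupType).
Variable J : {vspace group_algebra F aT}.
Hypothesis abT : abelian [set: aT].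
Hypothesis card18 : #|aT| = 18%N.
Hypothesis F2 : 2%:R != 0 :> F.
Hypothesis F9 : coprime 9 #|F|.-1.
Hypothesis idJ : is_left_ideal J.
Hypothesis dimJ : \dim J = 2.

Let mulC (g h : aT) : (g * h = h * g)%g.
Proof. by apply: (centsP abT); rewrite inE. Qed.

Let J_elt g z : z \in J -> ga_elt F g * z \in J.
Proof. by move=> Jz; apply: (subvP idJ); rewrite memv_mul ?memvf. Qed.

(* If an involution t acts as a scalar on J, zero sets are t-invariant, hence of even size.
   Otherwise J is the sum of two lines on which aT acts by characters with values of order
   prime to 3; these are trivial on the Sylow 3-subgroup, whose cosets have 9 elements. *)
Lemma abelian_code_zero_count z : z \in J ->
  #|[set g | ga_coef z g == 0]| != 3.
Proof.
move=> Jz.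
have [t _ ot] : {t | t \in [set: aT] & #[t]%g = 2}.
  by apply: Cauchy; rewrite // cardsT card18.
have tt : (t * t = 1)%g by have := expg_order t; rewrite ot.
pose T := ga_elt F t.
set Z := [set g | _].
have scalar_case (c : F) : c != 0 -> T * z = c *: z -> #|Z| != 3.
  move=> c0 Tz; suff : ~~ odd #|Z| by apply: contraNneq => ->.
  apply: even_card_involution ot _ => g.
  have -> : (g * t = t^-1 * g)%g.
    by rewrite mulC; congr (_ * _)%g; apply/eqP; rewrite eq_sym eq_invg_mul tt.
  by rewrite !inE -ga_coef_eltM Tz ga_coefZ mulf_eq0 (negPf c0).
have Jz' : T * z \in J by apply: J_elt.
have TT x : T * (T * x) = x by rewrite mulrA -ga_eltM tt ga_elt1 mul1r.
case: (eqVneq (z + T * z) 0) => [/eqP|x0].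
  rewrite addrC addr_eq0 => /eqP Tz; apply: (scalar_case (-1)).
    by rewrite oppr_eq0 oner_eq0.
  by rewrite scaleN1r.
case: (eqVneq (z - T * z) 0) => [/eqP|y0].
  rewrite subr_eq0 => /eqP Tz; apply: (scalar_case 1); first exact: oner_neq0.
  by rewrite scale1r.
(* These are twice the projections of [z] to the eigenspaces of [T] for 1 and -1. Both are nonzero
   here, so they form a basis of the plane [J]. *)
set x := z + _ in x0; set y := z - _ in y0.
have Jx : x \in J by rewrite memvD.
have Jy : y \in J by rewrite memvB.
have Tx : T * x = x by rewrite mulrDr TT addrC.
have Ty : T * y = - y by rewrite mulrBr TT opprB.
have twice_eq0 (u : group_algebra F aT) : u = - u -> u = 0.
  move=> /eqP; rewrite -addr_eq0 -[u]scale1r -scalerDl scaler_eq0.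
  by rewrite -[1 + 1]/(2%:R) (negPf F2) /= => /eqP->; rewrite scaler0.
have JE : J = <<[:: x; y]>>%VS.
  apply/eqP; rewrite eq_sym eqEdim; apply/andP; split.
    by apply/span_subvP => u; rewrite !inE => /orP[]/eqP->.
  suff : free [:: x; y] by rewrite /free => /eqP->; rewrite dimJ.
  rewrite free_cons seq1_free y0 andbT span_seq1; apply/negP => /vlineP[c e].
  case/eqP: x0; apply: twice_eq0.
  by rewrite -[LHS]Tx e -scalerAr Ty scalerN.
have JP u : u \in J -> exists k l, u = k *: x + l *: y.
  rewrite JE span_cons span_seq1 => /memv_addP[_ /vlineP[k ->] [_ /vlineP[l ->] ->]].
  by exists k, l.
have [P sylP] := Sylow_exists 3 [set: aT].
have cardP : #|P| = 9%N by rewrite (card_Hall sylP) cardsT card18 p_part.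
(* The eigenvalue satisfies k^9 = 1 since |P| = 9, and [F9] then gives k = 1. *)
have Pfix (h : aT) u k : h \in P -> u != 0 -> ga_elt F h * u = k *: u -> ga_elt F h * u = u.
  move=> Ph u0 hu; rewrite hu.
  have hn n : ga_elt F h ^+ n * u = k ^+ n *: u.
    elim: n => [|n IHn]; first by rewrite mul1r scale1r.
    by rewrite exprSr -mulrA hu -scalerAr IHn scalerA exprS.
  have k9 : k ^+ 9 = 1.
    have := hn 9%N; rewrite -ga_eltX -cardP expg_cardG // ga_elt1 mul1r cardP.
    move/eqP; rewrite -subr_eq0 -[X in X - _]scale1r -scalerBl scaler_eq0 (negPf u0) orbF.
    by rewrite subr_eq0 => /eqP.
  by rewrite (finField_coprime_root1 _ F9 k9) ?scale1r.
have comT h u : T * (ga_elt F h * u) = ga_elt F h * (T * u).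
  by rewrite !mulrA -!ga_eltM mulC.
(* As [T] commutes with [h], the vector h x stays in the 1-eigenspace of [T], so its [y] component
   vanishes. *)
have Px h : h \in P -> ga_elt F h * x = x.
  move=> Ph; have [k [l e]] := JP _ (J_elt h Jx); apply: (Pfix h x k Ph x0).
  have : l *: y = 0.
    apply: twice_eq0; apply: (addrI (k *: x)); rewrite -e -{1}Tx -comT.
    by rewrite e mulrDr -!scalerAr Tx Ty scalerN.
  by move=> ly; rewrite e ly addr0.
have Py h : h \in P -> ga_elt F h * y = y.
  move=> Ph; have [k [l e]] := JP _ (J_elt h Jy); apply: (Pfix h y l Ph y0).
  have : k *: x = 0.
    apply: twice_eq0; apply: (addIr (l *: y)); rewrite -e -[LHS]opprK -mulrN.
    by rewrite -Ty -comT e mulrDr -!scalerAr Tx Ty scalerN opprD opprK.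
  by move=> kx; rewrite e kx add0r.
have Pz h : h \in P -> ga_elt F h * z = z.
  by have [k [l ->]] := JP _ Jz => Ph; rewrite mulrDr -!scalerAr Px ?Py.
apply/eqP => Z3.
have /card_gt0P[g Zg] : (0 < #|Z|)%N by rewrite Z3.
(* One zero of [z] spreads to its whole coset of [P]: 9 zeros instead of 3. *)
suff /subset_leq_card : (P :* g)%g \subset Z by rewrite card_rcoset cardP Z3.
apply/subsetP => _ /rcosetP[h Ph ->]; rewrite inE -(Pz h Ph) ga_coef_eltM mulKg.
by rewrite inE in Zg.
Qed.
End AbelianCode.

(** If 3 divided q - 1, the cube of q would be 1 modulo 9, against order 6. *)
Lemma primitive_mod9_coprime q : (0 < q)%N ->
  (totient 9).-primitive_root (q%:R : 'Z_9) -> coprime 9 q.-1.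
Proof.
move=> q0 prim; rewrite (coprime_pexpl _ _ (isT : 0 < 2)%N : coprime (3 ^ 2) _ = _).
rewrite prime_coprime //; apply/negP => /dvdnP[k qk].
have q3 : (q%:R : 'Z_9) ^+ 3 = 1.
  rewrite -natrX; have -> : (q ^ 3 = 9 * (3 * k ^ 3 + 3 * k ^ 2 + k) + 1)%N.
    by rewrite -(prednK q0) qk; nia.
  rewrite natrD natrM; have -> : (9%:R : 'Z_9) = 0 by exact: pchar_Zp.
  by rewrite mul0r add0r.
by have := prim_order_dvd prim 3; rewrite q3 eqxx.
Qed.

Theorem mainTheorem1 (F : finFieldType) (gT : finGroupType) (a b : gT)
    (hF : forall p, p \in [pchar F] -> p \notin [:: 2; 3; 5; 7]%N)
    (hD : ([set: gT] \isog Grp (x : y : x ^+ 9, y ^+ 2, y * x * y = x^-1))%g)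
    (hgen : (<<[set a; b]>> = [set: gT])%g)
    (ha : (a ^+ 9 = 1)%g) (hb : (b ^+ 2 = 1)%g)
    (hab : (b * a * b = a^-1)%g) :
  let H0 : {set gT} := <[a]>%g in
  let H1 : {set gT} := <[(a ^+ 3)%g]>%g in
  let A := ga_elt F a in
  let B := ga_elt F b in
  let e := subgroup_avg F H1 - subgroup_avg F H0 in
  let e11 := ((2%:R : F)^-1 *: (1 + B)) * e in
  let e12 := ((2%:R : F)^-1 *: (1 + B)) * A * ((2%:R : F)^-1 *: (1 - B)) * e in
  let f := e11 - e12 in
  let I := left_principal_ideal f in
  [/\ \dim I = totient 3 /\ \dim I = 2%N,
      weight I = 15%N
    & (totient 9).-primitive_root (#|F|%:R : 'Z_9) ->
      ~~ is_ideal I /\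
      forall (aT : finGroupType) (J : {vspace group_algebra F aT}),
        abelian [set: aT] -> #|aT| = 18%N -> is_ideal J ->
        ~ combinatorially_equivalent I J].
Proof.
move=> H0 H1 A B e e11 e12 f I.
have nz p : prime p -> p \in [:: 2; 3; 5; 7]%N -> p%:R != 0 :> F.
  move=> pp ps; apply/negP => p0.
  have /hF : p \in [pchar F] by rewrite inE pp.
  by rewrite ps.
have [F2 F3 F5 F7] : [/\ 2%:R != 0 :> F, 3%:R != 0 :> F, 5%:R != 0 :> F & 7%:R != 0 :> F].
  by split; apply: nz.
have card18 := dihedral18_card hD.
have dimI : \dim I = 2 by exact: (dihedral_ideal_dim card18 hgen ha hb hab F2 F3 F5 F7).
split.
- by rewrite dimI.
- exact: (dihedral_ideal_weight card18 hgen ha hb hab F2 F3 F5 F7).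
move=> prim; split.
  exact: (dihedral_ideal_not_ideal card18 hgen ha hb hab F2 F3).
move=> aT J abT cardA /andP[idJ _] [phi [s s_bij phiE] phiI].
have s_inj := bij_inj s_bij.
have phi_coef x g := combinatorial_equivalence_coef x g s_inj phiE.
(* The map [phi] permutes coordinates, so its kernel is zero and it preserves dimension. *)
have dimJ : \dim J = 2.
  rewrite -phiI limg_dim_eq //; apply/eqP; rewrite -subv0; apply/subvP => x.
  rewrite memv_cap memv_ker memv0 => /andP[_ /eqP phix0].
  by apply/eqP/ga_coefP => g; rewrite -phi_coef phix0 !ga_coef0.
pose c := codeword a b (1 : F) (- 4%:R).
have c15 : #|[set g | ga_coef c g != 0]| = 15%N.
  exact: (codeword_weight15 card18 hgen ha hb hab F2 F3 F5 F7).
have Ic : c \in I.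
  have := codeword_span a b (1 : F) (- 4%:R).
  by rewrite -(dihedral_ideal_span card18 hgen ha hb hab F2 F3).
have F9 : coprime 9 #|F|.-1.
  by apply: primitive_mod9_coprime prim; apply: ltnW (finNzRing_gt1 _).
have Jc : phi c \in J by rewrite -phiI memv_img.
(* The word [phi c] has as many zeros as [c], namely 18 - 15 = 3. *)
case/eqP: (abelian_code_zero_count abT cardA F2 F9 idJ dimJ Jc).
have -> : [set h | ga_coef (phi c) h == 0] = s @: [set g | ga_coef c g == 0].
  have [s' s'K sK] := s_bij; apply/setP => h; rewrite -[h]sK inE phi_coef.
  by rewrite mem_imset // inE.
rewrite card_imset //.
have -> : [set g | ga_coef c g == 0] = ~: [set g | ga_coef c g != 0].
  by apply/setP => g; rewrite !inE negbK.
apply/eqP; rewrite -(eqn_add2l 15) -[X in (X + _)%N]c15 cardsC.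
by rewrite (bij_eq_card s_bij) cardA.
Qed.
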